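(* Let $n\ge 2$ and let $H(n,1)$ be a Heisenberg $n$-Lie algebra of dimension $n+1$ over a field. Then $$\mathcal{M}^{(2)}(H(n,1))\cong A\left(\frac{n^2+3n}{2}\right).$$
   Context: An $n$-Lie algebra is a vector space $L$ over a field with a multilinear skew-symmetric operation $[x_1,\ldots,x_n]$ satisfying $[[x_1,\ldots,x_n],y_2,\ldots,y_n]=\sum_{i=1}^n[x_1,\ldots,[x_i,y_2,\ldots,y_n],\ldots,x_n]$. For subalgebras $L_1,\dots,L_n$ of $L$, $[L_1,\dots,L_n]$ is the subalgebra generated by all $[x_1,\dots,x_n]$ with $x_i\in L_i$. The lower central series is $L^1=L$, $L^{i+1}=[L^i,L,\dots,L]$, and the center is $Z(L)=\{z\in L: [z,L,\dots,L]=0\}$. $L$ is abelian if $L^2=0$; $A(k)$ denotes the abelian $n$-Lie algebra of dimension $k$. An $n$-Lie algebra $L$ is Heisenberg if $L^2=Z(L)$ and $\dim L^2=1$. 2-nilpotent multiplier: let $0\to R\to F\to L\to 0$ be exact with $F$ a free $n$-Lie algebra. Then $\mathcal{M}^{(2)}(L)=\dfrac{R\cap F^{3}}{\gamma_{3}(R,F,\ldots,F)}$, where $\gamma_3(R,F,\dots,F)=[[R,F,\dots,F],F,\dots,F]$. *)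

(* Defs.v *)
From HB Require Import structures.
From mathcomp Require Import all_boot all_algebra perm.
From mathcomp Require Import boolp classical_sets.

Set Implicit Arguments.
Unset Strict Implicit.
Unset Printing Implicit Defensive.

Import GRing.Theory.
Local Open Scope ring_scope.
Local Open Scope classical_set_scope.
Local Open Scope quotient_scope.

(* The n-tuple (a, y_2, ..., y_n): the entry of y at position 0 is ignored. *)
Definition hd n T (a : T) (y : 'I_n -> T) : 'I_n -> T :=
  fun i => if val i == 0%N then a else y i.

Definition upd n T (x : 'I_n -> T) (i : 'I_n) (a : T) : 'I_n -> T :=
  fun j => if j == i then a else x j.

(* Skew-symmetry is taken in the alternating sense, the usual convention over
   a field of arbitrary characteristic; away from characteristic 2 it is
   equivalent to the sign rule (one direction is bracket_tperm below). *)
HB.mixin Record Lmodule_isNLie (n : nat) (K : fieldType) L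
    of GRing.Lmodule K L := {
  arity_gt1 : (1 < n)%N;
  bracket : ('I_n -> L) -> L;
  bracket_linear : forall x i, linear (fun a => bracket (upd x i a));
  bracket_alt : forall x i j, i != j -> x i = x j -> bracket x = 0;
  bracket_fundamental : forall x y,
    bracket (hd (bracket x) y) =
    \sum_(i < n) bracket (upd x i (bracket (hd (x i) y)))
}.

#[short(type="nLieType")]
HB.structure Definition NLie (n : nat) (K : fieldType) :=
  {L of GRing.Lmodule K L & Lmodule_isNLie n K L}.

Record nlieHom n K (L M : nLieType n K) := NLieHom {
  nlieHom_linear :> {linear L -> M};
  nlieHomP : forall x, nlieHom_linear (bracket x) =
                       bracket (fun i => nlieHom_linear (x i))
}.

Definition nlie_isog n K (L M : nLieType n K) : Prop :=
  exists f : nlieHom L M, bijective f.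

Section Subspaces.
Context (K : fieldType) (V : lmodType K).

Definition is_subspace (S : set V) : Prop :=
  S 0 /\ forall a x y, S x -> S y -> S (a *: x + y).

Definition has_dim (S : set V) (d : nat) : Prop :=
  exists b : 'I_d -> V,
    (forall c : 'I_d -> K, \sum_i c i *: b i = 0 -> forall i, c i = 0) /\
    S = [set \sum_i c i *: b i | c in [set: 'I_d -> K]].

End Subspaces.

Section Subobjects.
Context n (K : fieldType) (L : nLieType n K).

Definition is_subalgebra (S : set L) : Prop :=
  is_subspace S /\ forall x, (forall i, S (x i)) -> S (bracket x).

Definition is_ideal (I : set L) : Prop :=
  is_subspace I /\ forall x i, I (x i) -> I (bracket x).

(* [L_1, ..., L_n] *)
Definition bracket_sub (A : 'I_n -> set L) : set L :=
  smallest is_subalgebra [set bracket x | x in [set x | forall i, A i (x i)]].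

Definition center : set L := [set z | forall y, bracket (hd z y) = 0].

End Subobjects.

Arguments center {n K} L.

Record ideal n K (L : nLieType n K) := Ideal {
  ideal_set :> set L;
  idealP : is_ideal ideal_set
}.

Section Facts.
Context n (K : fieldType) (L : nLieType n K).
Implicit Types (x y : 'I_n -> L) (I J : ideal L).

Lemma arity_gt0 : (0 < n)%N.
Proof. exact: ltnW (@arity_gt1 _ _ L). Qed.

Lemma upd_id x i : upd x i (x i) = x.
Proof. by apply/funext => j; rewrite /upd; case: eqP => [->|]. Qed.

Lemma bracketP x i a u v :
  bracket (upd x i (a *: u + v)) =
  a *: bracket (upd x i u) + bracket (upd x i v) :> L.
Proof. exact: bracket_linear. Qed.

Lemma bracketD x i u v :
  bracket (upd x i (u + v)) = bracket (upd x i u) + bracket (upd x i v) :> L.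
Proof. by have := bracketP x i 1 u v; rewrite !scale1r. Qed.

Lemma bracket0 x i : bracket (upd x i 0) = 0 :> L.
Proof.
have := bracketD x i 0 0; rewrite addr0 => /eqP.
by rewrite eq_sym -subr_eq0 addrK => /eqP.
Qed.

Lemma bracketB x i u v :
  bracket (upd x i (u - v)) = bracket (upd x i u) - bracket (upd x i v) :> L.
Proof.
by rewrite -scaleN1r addrC bracketP scaleN1r addrC.
Qed.

Lemma bracket_tperm x i j : i != j ->
  bracket (x \o tperm i j) = - bracket x :> L.
Proof.
move=> ij; set s := x i + x j.
pose B u v : L := bracket (upd (upd x i u) j v).
have updC u v : upd (upd x i u) j v = upd (upd x j v) i u.
  apply/funext => k; rewrite /upd; case: eqP => [->|//].
  by rewrite eq_sym (negPf ij).
have Bxx u : B u u = 0.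
  apply: (@bracket_alt _ _ L _ i j ij).
  by rewrite /upd eqxx (negPf ij) eqxx.
have BDr u v w : B u (v + w) = B u v + B u w by rewrite /B bracketD.
have BDl u v w : B (u + v) w = B u w + B v w.
  by rewrite /B !updC bracketD.
have := Bxx s; rewrite /s BDr !BDl !Bxx add0r addr0 => /eqP.
rewrite addr_eq0 => /eqP BN.
have -> : x \o tperm i j = upd (upd x i (x j)) j (x i).
  apply/funext => k; rewrite /upd /=; case: tpermP => [->|->|].
  - by rewrite (negPf ij) eqxx.
  - by rewrite eqxx.
  - by move=> /eqP/negPf -> /eqP/negPf ->.
rewrite -[bracket (upd _ _ _)]/(B (x j) (x i)) BN; congr (- _).
by rewrite /B upd_id -{1}[x](upd_id x i) upd_id upd_id.
Qed.

Lemma ideal_subspace I : is_subspace I.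
Proof. by case: I => ? []. Qed.

Lemma ideal_bracket I x i : ideal_set I (x i) -> ideal_set I (bracket x).
Proof. by case: I => ? [_ /=]; apply. Qed.

Lemma setT_is_ideal : is_ideal [set: L]. Proof. by []. Qed.
Definition idealT := Ideal setT_is_ideal.

Lemma setI_is_ideal I J : is_ideal (ideal_set I `&` ideal_set J).
Proof.
have [I0 IP] := ideal_subspace I; have [J0 JP] := ideal_subspace J.
split; first by split=> // a x y [] ? ? [] ? ?; split; [apply: IP|apply: JP].
by move=> x i [] Ix Jx; split; apply: (ideal_bracket (i := i)).
Qed.
Definition idealI I J := Ideal (setI_is_ideal I J).

Lemma comm_is_ideal I :
  is_ideal (bracket_sub (hd (ideal_set I) (fun=> setT))).
Proof.
set B := bracket_sub _.
pose G := [set bracket x |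
  x in [set x | forall i, hd (ideal_set I) (fun=> setT) i (x i)]] : set L.
pose S := smallest (@is_subspace K L) G.
have S_sub : is_subspace S.
  split=> [T [[T0 _] _] //|a x y Sx Sy T TG].
  by case: (TG) => [[_ TP] _]; apply: TP; [apply: Sx|apply: Sy].
have GI x : (forall i : 'I_n, val i = 0%N -> ideal_set I (x i)) -> G (bracket x).
  move=> xI; exists x => //= i; rewrite /hd; case: eqP => // i0; exact: xI.
have S_head (i0 : 'I_n) : val i0 = 0%N ->
    S `<=` [set g | forall y, S (bracket (hd g y))].
  move=> i00; have hdE g y : hd g y = upd y i0 g :> ('I_n -> L).
    apply/funext => j; rewrite /hd /upd -[0%N]i00.
    by rewrite (inj_eq val_inj).
  apply: smallest_sub.
    split=> [y|a x y Sx Sy z]; first by rewrite hdE bracket0; case: S_sub.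
    by rewrite hdE bracketP; apply: S_sub.2; rewrite -hdE.
  move=> _ [x xI <-] y; rewrite bracket_fundamental.
  elim/big_rec : _ => [|i u _ Su]; first by case: S_sub.
  rewrite -[X in X + _]scale1r; apply: S_sub.2 => //.
  apply: sub_gen_smallest; apply: GI => j j0; rewrite /upd.
  have := xI j; rewrite /hd j0 eqxx => xjI.
  case: eqP => // <-; apply: (ideal_bracket (i := j)).
  by rewrite /hd j0.
have S_bracket x i : S (x i) -> S (bracket x).
  pose i0 := Ordinal arity_gt0.
  have hdS g : S (g i0) -> S (bracket g).
    move=> /(S_head i0 erefl) /(_ g); congr (S (bracket _)).
    apply/funext => j; rewrite /hd; case: eqP => // j0.
    by congr g; apply: val_inj; rewrite /= j0.
  have [->|ne] := eqVneq i i0; first exact: hdS.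
  move=> Sxi; have := hdS (x \o tperm i i0).
  rewrite /= tpermR bracket_tperm // => /(_ Sxi) SN.
  by have := S_sub.2 (-1) _ _ SN S_sub.1; rewrite scaleN1r opprK addr0.
have S_alg : is_subalgebra S.
  by split=> // x Sx; apply: (S_bracket _ (Ordinal arity_gt0)).
suff -> : B = S by split=> // x i; apply: S_bracket.
apply/seteqP; split; first by apply: smallest_sub => //; apply: sub_gen_smallest.
by move=> x Sx T [[TS _] TG]; apply: Sx.
Qed.
(* [I, L, ..., L] *)
Definition comm_ideal I := Ideal (comm_is_ideal I).

(* L^k for k >= 1, with L^1 = L. *)
Definition lcs (k : nat) : ideal L := iter k.-1 comm_ideal idealT.

Definition heisenberg : Prop :=
  ideal_set (lcs 2) = center L /\ has_dim (lcs 2) 1.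

Lemma upd_bracket0 x i : x i = 0 -> bracket x = 0 :> L.
Proof. by move=> x0; rewrite -(upd_id x i) x0 bracket0. Qed.

(* Two tuples congruent modulo an ideal have congruent brackets. *)
Lemma bracket_congr I x y :
  (forall i, ideal_set I (x i - y i)) -> ideal_set I (bracket x - bracket y).
Proof.
move=> xy; have [I0 IP] := ideal_subspace I.
pose z (k : nat) : 'I_n -> L := fun i => if (i < k)%N then y i else x i.
suff zP k : (k <= n)%N -> ideal_set I (bracket x - bracket (z k)).
  have -> : y = z n by apply/funext => i; rewrite /z ltn_ord.
  exact: zP.
elim: k => [|k IHk] kn.
  suff -> : z 0%N = x by rewrite subrr.
  by apply/funext => i; rewrite /z ltn0.
pose i := Ordinal kn.
have z1 : z k = upd (z k) i (x i).
  by rewrite -[LHS](upd_id _ i) {2}/z ltnn.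
have z2 : z k.+1 = upd (z k) i (y i).
  apply/funext => j; rewrite /upd /z ltnS leq_eqVlt -val_eqE /=.
  by case: eqP => // /esym ki; congr y; apply: val_inj.
rewrite -(subrK (bracket (z k)) (bracket x)) -addrA -[X in X + _]scale1r.
apply: IP; first exact: IHk (ltnW kn).
rewrite {1}z1 z2 -bracketB; apply: (ideal_bracket (i := i)).
by rewrite /upd eqxx.
Qed.

End Facts.

Arguments lcs {n K} L k.
Arguments heisenberg {n K} L.

Definition ker_set n K (L M : nLieType n K) (f : nlieHom L M) : set L :=
  [set x | f x = 0].

Lemma ker_is_ideal n K (L M : nLieType n K) (f : nlieHom L M) :
  is_ideal (ker_set f).
Proof.
split=> [|x i fx]; last by rewrite /ker_set /= nlieHomP (upd_bracket0 fx).
split=> [|a x y]; rewrite /ker_set /= ?linear0 // linearP => -> ->.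
by rewrite scaler0 addr0.
Qed.
Definition ker n K (L M : nLieType n K) (f : nlieHom L M) : ideal L :=
  Ideal (ker_is_ideal f).

Section IdealPred.
Context n (K : fieldType) (L : nLieType n K) (I : ideal L).

Definition ideal_pred : {pred L} := fun x => `[< ideal_set I x >].

Lemma ideal_predP x : reflect (ideal_set I x) (x \in ideal_pred).
Proof. exact: asboolP. Qed.

Lemma ideal_pred_submod : submod_closed ideal_pred.
Proof.
have [I0 IP] := ideal_subspace I.
split=> [|a x y /ideal_predP Ix /ideal_predP Iy]; apply/ideal_predP => //.
exact: IP.
Qed.

HB.instance Definition _ :=
  GRing.isSubmodClosed.Build K L ideal_pred ideal_pred_submod.

(* The ideal I regarded as an n-Lie algebra. *)
Record ideal_type := IdealType {
  ideal_val :> L;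
  ideal_valP : ideal_val \in ideal_pred
}.

HB.instance Definition _ := [isSub for ideal_val].
HB.instance Definition _ := [Choice of ideal_type by <:].
HB.instance Definition _ := [SubChoice_isSubLmodule of ideal_type by <:].

Lemma ideal_valZD a (u v : ideal_type) :
  ideal_val (a *: u + v) = a *: ideal_val u + ideal_val v.
Proof. exact: (linearP (val : ideal_type -> L)). Qed.

Lemma ideal_val0 : ideal_val 0 = 0.
Proof. exact: (raddf0 (val : ideal_type -> L)). Qed.

Lemma ideal_val_sum (u : 'I_n -> ideal_type) :
  ideal_val (\sum_i u i) = \sum_i ideal_val (u i).
Proof. exact: (raddf_sum (val : ideal_type -> L)). Qed.

Lemma ideal_type_bracket_proof (x : 'I_n -> ideal_type) :
  bracket (fun i => ideal_val (x i)) \in ideal_pred.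
Proof.
apply/ideal_predP; apply: (ideal_bracket (i := Ordinal (arity_gt0 L))).
exact/ideal_predP/ideal_valP.
Qed.

Definition ideal_type_bracket x := IdealType (ideal_type_bracket_proof x).

Lemma ideal_val_hd a (y : 'I_n -> ideal_type) :
  (fun i => ideal_val (hd a y i)) = hd (ideal_val a) (fun i => ideal_val (y i)).
Proof. by apply/funext => i; rewrite /hd; case: ifP. Qed.

Lemma ideal_val_upd (x : 'I_n -> ideal_type) i a :
  (fun j => ideal_val (upd x i a j)) =
  upd (fun j => ideal_val (x j)) i (ideal_val a).
Proof. by apply/funext => j; rewrite /upd; case: ifP. Qed.

Lemma ideal_type_linear x i :
  linear (fun a => ideal_type_bracket (upd x i a)).
Proof.
move=> a u v; apply: val_inj; rewrite [RHS]ideal_valZD /=.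
by rewrite !ideal_val_upd -bracketP -ideal_valZD.
Qed.

Lemma ideal_type_alt x i j :
  i != j -> x i = x j -> ideal_type_bracket x = 0.
Proof.
move=> ij xij; apply: val_inj; rewrite [RHS]ideal_val0 /=.
by apply: bracket_alt ij _; rewrite xij.
Qed.

Lemma ideal_type_fundamental x y :
  ideal_type_bracket (hd (ideal_type_bracket x) y) =
  \sum_(i < n) ideal_type_bracket (upd x i (ideal_type_bracket (hd (x i) y))).
Proof.
apply: val_inj; rewrite [RHS]ideal_val_sum /= ideal_val_hd bracket_fundamental.
by apply: eq_bigr => i _; rewrite ideal_val_upd /= ideal_val_hd.
Qed.

HB.instance Definition _ := Lmodule_isNLie.Build n K ideal_type
  (@arity_gt1 _ _ L) ideal_type_linear ideal_type_alt ideal_type_fundamental.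

End IdealPred.

Section Quotient.
Context n (K : fieldType) (L : nLieType n K) (I : ideal L).

Definition quot_nlie : Type := Quotient.quot (ideal_pred I).
HB.instance Definition _ := GRing.Zmodule.on quot_nlie.

Definition quot_proj (x : L) : quot_nlie := \pi x.

Lemma quot_projP x y : ideal_set I (x - y) <-> quot_proj x = quot_proj y.
Proof.
split=> [/ideal_predP|/eqP]; first by rewrite Quotient.idealrBE => /eqP.
by rewrite /quot_proj -Quotient.idealrBE => /ideal_predP.
Qed.

Lemma quot_projK (u : quot_nlie) : quot_proj (repr u) = u.
Proof. exact: reprK. Qed.

Lemma quot_projD x y : quot_proj (x + y) = quot_proj x + quot_proj y.
Proof. by rewrite /quot_proj piE. Qed.

Lemma quot_proj0 : quot_proj 0 = 0.
Proof. by apply: (addrI (quot_proj 0)); rewrite -quot_projD !addr0. Qed.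

Definition quot_scale (a : K) (u : quot_nlie) : quot_nlie :=
  quot_proj (a *: repr u).

Lemma quot_projZ a x : quot_proj (a *: x) = quot_scale a (quot_proj x).
Proof.
apply/quot_projP; rewrite -scalerBr; apply/ideal_predP/rpredZ/ideal_predP.
by apply/quot_projP; rewrite quot_projK.
Qed.

Fact quot_scaleA a b u : quot_scale a (quot_scale b u) = quot_scale (a * b) u.
Proof. by rewrite -quot_projZ scalerA. Qed.
Fact quot_scale1 : left_id 1 quot_scale.
Proof. by move=> u; rewrite /quot_scale scale1r quot_projK. Qed.
Fact quot_scaleDr : right_distributive quot_scale +%R.
Proof.
move=> a u v; rewrite -[u]quot_projK -[v]quot_projK -quot_projD -!quot_projZ.
by rewrite scalerDr quot_projD.
Qed.
Fact quot_scaleDl u : {morph quot_scale^~ u : a b / a + b}.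
Proof. by move=> a b; rewrite /quot_scale scalerDl quot_projD. Qed.

HB.instance Definition _ := GRing.Zmodule_isLmodule.Build K quot_nlie
  quot_scaleA quot_scale1 quot_scaleDr quot_scaleDl.

Fact quot_proj_linear : linear quot_proj.
Proof. by move=> a x y; rewrite quot_projD quot_projZ. Qed.
HB.instance Definition _ :=
  GRing.isLinear.Build K L quot_nlie _ quot_proj quot_proj_linear.

Definition quot_bracket (u : 'I_n -> quot_nlie) : quot_nlie :=
  quot_proj (bracket (fun i => repr (u i))).

Lemma quot_bracketE (x : 'I_n -> L) :
  quot_bracket (fun i => quot_proj (x i)) = quot_proj (bracket x).
Proof.
apply/quot_projP/bracket_congr => i; apply/quot_projP.
by rewrite quot_projK.
Qed.

Lemma quot_lift (u : 'I_n -> quot_nlie) :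
  exists x : 'I_n -> L, u = fun i => quot_proj (x i).
Proof.
by exists (fun i => repr (u i)); apply/funext => i; rewrite quot_projK.
Qed.

Lemma quot_proj_upd (x : 'I_n -> L) i a :
  upd (fun j => quot_proj (x j)) i (quot_proj a) =
  fun j => quot_proj (upd x i a j).
Proof. by apply/funext => j; rewrite /upd; case: ifP. Qed.

Lemma quot_proj_hd a (y : 'I_n -> L) :
  hd (quot_proj a) (fun i => quot_proj (y i)) =
  fun i => quot_proj (hd a y i).
Proof. by apply/funext => i; rewrite /hd; case: ifP. Qed.

Fact quot_bracket_linear x i : linear (fun a => quot_bracket (upd x i a)).
Proof.
have [{}x ->] := quot_lift x => a u v.
rewrite -[u]quot_projK -[v]quot_projK -linearP /= !quot_proj_upd !quot_bracketE.
by rewrite bracketP linearP.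
Qed.

Fact quot_bracket_alt x i j : i != j -> x i = x j -> quot_bracket x = 0.
Proof.
move=> ij xij; rewrite /quot_bracket (@bracket_alt _ _ L _ i j ij) ?quot_proj0 //.
by rewrite xij.
Qed.

Fact quot_bracket_fundamental x y :
  quot_bracket (hd (quot_bracket x) y) =
  \sum_(i < n) quot_bracket (upd x i (quot_bracket (hd (x i) y))).
Proof.
have [{}x ->] := quot_lift x; have [{}y ->] := quot_lift y.
rewrite quot_bracketE quot_proj_hd quot_bracketE bracket_fundamental linear_sum.
apply: eq_bigr => i _.
by rewrite quot_proj_hd quot_bracketE quot_proj_upd quot_bracketE.
Qed.

HB.instance Definition _ := Lmodule_isNLie.Build n K quot_nlie
  (@arity_gt1 _ _ L) quot_bracket_linear quot_bracket_alt
  quot_bracket_fundamental.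

End Quotient.

Section RestrictIdeal.
Context n (K : fieldType) (L : nLieType n K) (J I : ideal L).

Lemma restrict_is_ideal :
  is_ideal [set x : ideal_type J | ideal_set I (ideal_val x)].
Proof.
have [I0 IP] := ideal_subspace I.
split=> [|x i /= Ix]; last exact: (ideal_bracket (i := i)).
split=> [|a x y Ix Iy]; first by have := ideal_val0 J; rewrite /= => ->.
have /= -> := ideal_valZD a x y; exact: IP.
Qed.

(* The ideal J :&: I of the n-Lie algebra J. *)
Definition restrict_ideal : ideal (ideal_type J) := Ideal restrict_is_ideal.

End RestrictIdeal.

(* F is free on the family iota, X being an arbitrary (possibly infinite) set
   of generators. *)
Definition free_on n (K : fieldType) (X : Type) (F : nLieType n K)
    (iota : X -> F) : Prop :=
  forall (M : nLieType n K) (f : X -> M),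
    (exists g : nlieHom F M, forall x, g (iota x) = f x) /\
    (forall g h : nlieHom F M,
       (forall x, g (iota x) = f x) -> (forall x, h (iota x) = f x) -> g =1 h).

(* gamma_3(R, F, ..., F) = [[R, F, ..., F], F, ..., F] *)
Definition gamma3 n (K : fieldType) (F : nLieType n K) (R : ideal F) : ideal F :=
  comm_ideal (comm_ideal R).

Lemma bracket_sub_mono n (K : fieldType) (L : nLieType n K)
    (A B : 'I_n -> set L) :
  (forall i, A i `<=` B i) -> bracket_sub A `<=` bracket_sub B.
Proof.
move=> AB x Ax T [T1 T2]; apply: Ax; split=> // _ [y Ay <-].
by apply: T2; exists y => // i; apply: AB.
Qed.

Lemma comm_ideal_sub n (K : fieldType) (L : nLieType n K) (I : ideal L) :
  ideal_set (comm_ideal I) `<=` ideal_set I.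
Proof.
apply: smallest_sub.
  split=> [|x Ix]; first exact: ideal_subspace.
  exact: (ideal_bracket (i := Ordinal (arity_gt0 L))).
move=> _ [x xI <-]; pose i0 := Ordinal (arity_gt0 L).
by apply: (ideal_bracket (i := i0)); apply: (xI i0).
Qed.

Lemma gamma3_sub n (K : fieldType) (F : nLieType n K) (R : ideal F) :
  ideal_set (gamma3 R) `<=` ideal_set (idealI R (lcs F 3)).
Proof.
move=> x Rx; split; first by apply/comm_ideal_sub/comm_ideal_sub.
apply: bracket_sub_mono Rx => i; rewrite /hd; case: ifP => // _.
by apply: bracket_sub_mono => j; rewrite /hd; case: ifP.
Qed.

(* (R :&: F^3) / gamma_3(R, F, ..., F) with R = ker p, for a free presentation
   p : F -> L; see gamma3_sub for the inclusion. *)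
Definition multiplier2 n (K : fieldType) (F L : nLieType n K)
    (p : nlieHom F L) : nLieType n K :=
  quot_nlie (restrict_ideal (idealI (ker p) (lcs F 3)) (gamma3 (ker p))).

(* A(k): K^k with the zero bracket. *)
Definition abelian_nlie n (n_gt1 : (1 < n)%N) (K : fieldType) (k : nat) : Type :=
  'rV[K]_k.

Section Abelian.
Context n (n_gt1 : (1 < n)%N) (K : fieldType) (k : nat).
Local Notation abelian_nlie := (abelian_nlie n_gt1 K k).

HB.instance Definition _ := GRing.Lmodule.on abelian_nlie.

Definition abelian_bracket (x : 'I_n -> abelian_nlie) : abelian_nlie := 0.

Fact abelian_linear x i : linear (fun a => abelian_bracket (upd x i a)).
Proof. by move=> a u v; rewrite /abelian_bracket scaler0 addr0. Qed.

Fact abelian_alt x i j : i != j -> x i = x j -> abelian_bracket x = 0.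
Proof. by []. Qed.

Fact abelian_fundamental x y :
  abelian_bracket (hd (abelian_bracket x) y) =
  \sum_(i < n) abelian_bracket (upd x i (abelian_bracket (hd (x i) y))).
Proof. by rewrite /abelian_bracket big1. Qed.

HB.instance Definition _ := Lmodule_isNLie.Build n K abelian_nlie
  n_gt1 abelian_linear abelian_alt abelian_fundamental.

End Abelian.

(* Main.v *)
Require Import Defs.
From HB Require Import structures.
From mathcomp Require Import all_boot all_algebra perm ring.
From mathcomp Require Import boolp classical_sets.

Set Implicit Arguments.
Unset Strict Implicit.
Unset Printing Implicit Defensive.

Import GRing.Theory.
Local Open Scope ring_scope.
Local Open Scope classical_set_scope.

(** Write R for the kernel of p, lift a basis x_1, ..., x_n, [x_1, ..., x_n] of
H to F through elements a_1, ..., a_n of F and c = [a_1, ..., a_n], and let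
[.., u, ..]_j denote the bracket of the tuple a with its j-th entry replaced by
u. Put w_j = [.., c, ..]_j, which lies in R and in F^3, and
w_jk = [.., w_j, ..]_k. Since F^3 is contained in R, the multiplier is
F^3 / gamma_3(R), and the theorem says that the w_j and the w_jk with j <= k
form a basis of it: there are n + n(n+1)/2 of them.

Spanning. The space F is spanned by the a_j, c and R. Expanding brackets by
multilinearity, every term with two factors c vanishes by alternation, and
every term with one entry in F^2 and another one in R lies in gamma_3(R): by
the fundamental identity, bracketing an element [y_1, ..., y_n] with an element
of R gives brackets of elements of [R, F, ..., F] (comm2_bracket). What remains
is a multiple of some w_j or w_jk. Finally w_jk = w_kj exactly: expand
[c, c, a_i (i <> j, k)] = 0 by the fundamental identity, with one factor c
written as [a_1, ..., a_n] (iterated_bracketC).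

Independence. This needs an n-Lie algebra in which the w_j and w_jk can be
told apart. For theta in K^n let E be the space of pairs (v, f) with v in K^n
and f in K[t], with bracket
  [(v_1, f_1), ..., (v_n, f_n)] = (0, det (v_i + f_i t theta)).
The fundamental identity of E is Cramer's rule (det_fundamental). The map
(v, f) |-> v_1 x_1 + ... + v_n x_n + f(0) [x_1, ..., x_n] is a homomorphism
E -> H, and freeness of F lifts p through it to g : F -> E
(presentation_lift). Then g(R) lies in the pairs (0, t f), each further bracket
with F gains one factor t, so gamma_3(R) goes to (0, t^3 K[t]); whereas
g(w_j) = (0, theta_j t + ...) and g(w_jk) = (0, theta_j theta_k t^2 + ...).
A relation among the w_j and w_jk modulo gamma_3(R) thus gives a linear and a
quadratic form that vanish at every theta. Evaluating at the unit vectors and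
at the sums of two of them kills all coefficients, over any field, F_2
included (weights_independent). *)

(** * Multilinear expansion *)

Section Update.
Context (n : nat) (T : Type).
Implicit Types (x : 'I_n -> T) (i j : 'I_n) (u : T).

Lemma updE x i u : upd x i u i = u.
Proof. by rewrite /upd eqxx. Qed.

Lemma upd_neq x i j u : j != i -> upd x i u j = x j.
Proof. by rewrite /upd => /negPf ->. Qed.

Lemma upd_same x i : upd x i (x i) = x.
Proof. by apply/funext => j; rewrite /upd; case: eqP => [->|]. Qed.

End Update.

Section Span.
Context (K : fieldType) (V : lmodType K).
Implicit Types (S G : set V).

Definition lin_span G : set V := smallest (@is_subspace K V) G.

Lemma lin_span_subspace G : is_subspace (lin_span G).
Proof.
split=> [T [[T0 _] _] //|a x y Sx Sy T TG].
by case: (TG) => [[_ TP] _]; apply: TP; [apply: Sx|apply: Sy].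
Qed.

Lemma subspaceZ S a x : is_subspace S -> S x -> S (a *: x).
Proof. by case=> S0 SP Sx; rewrite -[_ *: _]addr0; apply: SP. Qed.

Lemma subspaceD S x y : is_subspace S -> S x -> S y -> S (x + y).
Proof. by case=> S0 SP Sx Sy; rewrite -[x]scale1r; apply: SP. Qed.

Lemma subspace_sum S I (r : seq I) (P : pred I) (b : I -> V) :
  is_subspace S -> (forall i, P i -> S (b i)) -> S (\sum_(i <- r | P i) b i).
Proof.
move=> S_sub Sb; elim/big_rec: _ => [|i x Pi Sx]; first by case: S_sub.
exact: subspaceD (Sb i Pi) Sx.
Qed.

Lemma subspace0 : is_subspace [set 0 : V].
Proof. by split=> [|a x y -> ->] //=; rewrite scaler0 addr0. Qed.

(** Multilinear expansion as an induction principle: a property that is linear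
in each entry separately may be checked on tuples of generators. No sum over
maps between index sets has to be written. *)
Lemma multilinear_ind n (G : 'I_n -> set V) (Q : ('I_n -> V) -> Prop) :
  (forall x i, is_subspace [set a | Q (upd x i a)]) ->
  (forall x, (forall i, G i (x i)) -> Q x) ->
  forall x, (forall i, lin_span (G i) (x i)) -> Q x.
Proof.
move=> Q_sub QG x xG.
suff QP k : (k <= n)%N -> forall y : 'I_n -> V,
    (forall i : 'I_n, (i < k)%N -> lin_span (G i) (y i)) ->
    (forall i : 'I_n, (k <= i)%N -> G i (y i)) -> Q y.
  by apply: (QP n) => // i; rewrite leqNgt ltn_ord.
elim: k => [_ y _ yG|k IHk kn y yS yG]; first by apply: QG => i; apply: yG.
pose i := Ordinal kn.
rewrite -(upd_same y i).
have: lin_span (G i) (y i) by apply: yS.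
suff: lin_span (G i) `<=` [set a | Q (upd y i a)] by apply.
apply: smallest_sub => // a Ga.
apply: IHk => [|j jk|j]; first exact: ltnW.
  rewrite /upd; case: eqP => [ji|_]; last by apply: yS; apply: ltnW.
  by rewrite ji /= ltnn in jk.
rewrite leq_eqVlt => /orP[/eqP kj|kj].
  by have -> : j = i by [apply: val_inj]; rewrite /upd eqxx.
rewrite /upd; case: eqP => [ji|_]; last exact: yG.
by rewrite ji /= ltnn in kj.
Qed.

End Span.

(** * Brackets and ideals *)

Section Brackets.
Context n (K : fieldType) (L : nLieType n K).
Implicit Types (x y a : 'I_n -> L) (I : ideal L) (P : set L).

Definition ord_fst : 'I_n := Ordinal (arity_gt0 L).

Lemma hdE u y : hd u y = upd y ord_fst u.
Proof.
apply/funext => j; rewrite /hd /upd.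
by rewrite -[0%N]/(val ord_fst) (inj_eq val_inj).
Qed.

Lemma bracket_subspace P x i :
  is_subspace P -> is_subspace [set u | P (bracket (upd x i u))].
Proof.
case=> P0 PP; split=> [|a u v Pu Pv]; first by rewrite /= bracket0.
by rewrite /= bracketP; apply: PP.
Qed.

Lemma bracketZ x i e u : bracket (upd x i (e *: u)) = e *: bracket (upd x i u).
Proof. by rewrite -[_ *: _ in LHS]addr0 bracketP bracket0 addr0. Qed.

Lemma bracket_perm x (s : {perm 'I_n}) :
  bracket (x \o s) = (-1) ^+ s *: bracket x.
Proof.
have [ts -> /=] := prod_tpermP s; elim: ts x => [|t ts IHts] x /=.
  move=> _; rewrite big_nil odd_perm1 expr0 scale1r; congr bracket.
  by apply/funext => i /=; rewrite perm1.
case/andP=> dt dts; rewrite big_cons odd_permM odd_tperm dt.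
have -> : x \o (tperm t.1 t.2 * \prod_(j <- ts) tperm j.1 j.2)%g =
    (x \o (\prod_(j <- ts) tperm j.1 j.2)%g) \o tperm t.1 t.2.
  by apply/funext => i /=; rewrite permM.
rewrite bracket_tperm // IHts // signr_addb expr1 mulN1r scaleNr.
by [].
Qed.

Lemma bracket_noninj (T : Type) (x : T -> L) (f : 'I_n -> T) i j :
  i != j -> f i = f j -> bracket (x \o f) = 0.
Proof. by move=> ij fij; apply: (@bracket_alt _ _ L _ _ _ ij); rewrite /= fij. Qed.

Lemma bracket_to_first x i :
  exists2 e : K, bracket x = e *: bracket (x \o tperm i ord_fst) & e != 0.
Proof.
exists ((-1) ^+ tperm i ord_fst); last by rewrite signr_eq0.
rewrite -bracket_perm; congr bracket; apply/funext => j /=.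
by rewrite tpermK.
Qed.

(** The fundamental identity distinguishes the first position, but the sign of
moving that entry to position k occurs on both sides. *)
Lemma fundamental_at x y k :
  bracket (upd y k (bracket x)) =
  \sum_i bracket (upd x i (bracket (upd y k (x i)))).
Proof.
pose t := tperm k ord_fst; pose e := (-1) ^+ t : K.
have updT u : bracket (upd y k u) = e *: bracket (hd u (y \o t)).
  rewrite hdE -bracket_perm; congr bracket; apply/funext => j; rewrite /= /upd.
  rewrite (can2_eq (tpermK _ _) (tpermK _ _)) tpermR /t /=.
  by rewrite tpermK.
rewrite updT bracket_fundamental scaler_sumr; apply: eq_bigr => i _.
by rewrite updT bracketZ.
Qed.

Lemma comm_bracket I x i : ideal_set I (x i) -> ideal_set (comm_ideal I) (bracket x).
Proof.
move=> Ixi; have [e -> _] := bracket_to_first x i.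
apply: (subspaceZ _ (ideal_subspace (comm_ideal I))).
apply: sub_gen_smallest; exists (x \o tperm i ord_fst) => //= j.
rewrite /hd; case: eqP => // j0; have -> : j = ord_fst by apply: val_inj.
by rewrite tpermR.
Qed.

(** The ideal [I, L, ..., L] is generated as a subalgebra, yet its brackets
already span it: if P is a subspace containing them, the intersection of P and I
is a subalgebra, because a bracket of elements of I is one of them. *)
Lemma comm_ideal_ind I P : is_subspace P ->
  (forall x, ideal_set I (x ord_fst) -> P (bracket x)) ->
  ideal_set (comm_ideal I) `<=` P.
Proof.
move=> P_sub PI; have I_sub := ideal_subspace I.
suff: ideal_set (comm_ideal I) `<=` ideal_set I `&` P by move=> h u /h [].
apply: smallest_sub.
  split=> [|x IPx]; last first.
    by split; [apply: (ideal_bracket (i := ord_fst)); case: (IPx ord_fst)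
              |apply: PI; case: (IPx ord_fst)].
  split=> [|b u v [Iu Pu] [Iv Pv]]; first by split; [case: I_sub|case: P_sub].
  by split; [apply: I_sub.2|apply: P_sub.2].
move=> _ [x xI <-]; have := xI ord_fst; rewrite /hd /= => Ix.
by split; [apply: (ideal_bracket (i := ord_fst))|apply: PI].
Qed.

(** If x_i = [y_1, ..., y_n], the fundamental identity moves the entry x_j of I
inside, next to each y_k, and produces brackets of elements of [I, L, ..., L]. *)
Lemma comm2_bracket I x i j : i != j ->
  ideal_set (lcs L 2) (x i) -> ideal_set I (x j) ->
  ideal_set (comm_ideal (comm_ideal I)) (bracket x).
Proof.
move=> ij xi Ixj; rewrite -(upd_same x i).
set C := comm_ideal (comm_ideal I); have C_sub := ideal_subspace C.
suff: ideal_set (lcs L 2) `<=` [set u | ideal_set C (bracket (upd x i u))] by apply.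
apply: comm_ideal_ind => [|y _ /=]; first exact: bracket_subspace.
rewrite fundamental_at; apply: subspace_sum => // k _.
apply: (comm_bracket (I := comm_ideal I) (i := k)); rewrite updE.
by apply: (comm_bracket (I := I) (i := j)); rewrite upd_neq // eq_sym.
Qed.

Lemma bracket_reindex a (f : 'I_n -> 'I_n) :
  exists e : K, bracket (a \o f) = e *: bracket a.
Proof.
have [/injectiveP f_inj|/injectivePn [i [j ij fij]]] := boolP (injectiveb f).
  exists ((-1) ^+ perm f_inj); rewrite -bracket_perm; congr bracket.
  by apply/funext => i /=; rewrite permE.
by exists 0; rewrite scale0r (bracket_noninj _ ij).
Qed.

(** The n - 1 entries other than u omit at least one generator a_k; if they are
distinct they are all the others, up to order. *)
Lemma bracket_reindex_upd a (f : 'I_n -> 'I_n) i u :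
  exists k (e : K), bracket (upd (a \o f) i u) = e *: bracket (upd a k u).
Proof.
have [k kf] : exists k, forall j, j != i -> f j != k.
  pose S := [set f j | j in [set~ i]]%SET.
  have : (#|~: S| > 0)%N.
    rewrite cardsCs finset.setCK card_ord subn_gt0.
    apply: leq_ltn_trans (leq_imset_card _ _) _.
    by rewrite cardsC1 card_ord prednK ?leqnn // (arity_gt0 L).
  case/card_gt0P=> k; rewrite inE => kS; exists k => j ji.
  apply: contra kS => /eqP <-; apply/imsetP; exists j => //.
  by rewrite !inE.
exists k; pose g j := if j == i then k else f j.
have [/injectiveP g_inj|/injectivePn [j [l jl gjl]]] := boolP (injectiveb g).
  exists ((-1) ^+ perm g_inj); rewrite -bracket_perm; congr bracket.
  apply/funext => j; rewrite /= permE /upd /g.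
  by case: (eqVneq j i) => [_|/kf/negPf -> //]; rewrite eqxx.
exists 0; rewrite scale0r; apply: (@bracket_alt _ _ L _ _ _ jl).
rewrite /upd; move: gjl; rewrite /g.
have [ji|ji] := eqVneq j i; have [li|li] := eqVneq l i => //.
- by move=> E; have := kf _ li; rewrite -E eqxx.
- by move=> E; have := kf _ ji; rewrite E eqxx.
- by rewrite /= => ->.
Qed.

(** With c = [a_1, ..., a_n], the bracket having c at positions j and k and
a_i elsewhere is zero. Expanding the factor c at position k by the fundamental
identity leaves two terms, which are the two sides. *)
Lemma iterated_bracketC a j k :
  bracket (upd a k (bracket (upd a j (bracket a)))) =
  bracket (upd a j (bracket (upd a k (bracket a)))).
Proof.
have [->//|jk] := eqVneq j k.
set c := bracket a; apply/eqP; rewrite -subr_eq0; apply/eqP.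
have zero : bracket (upd (upd a j c) k c) = 0.
  by apply: (@bracket_alt _ _ L _ _ _ jk); rewrite updE upd_neq // updE.
have atk : upd (upd a j c) k (a k) = upd a j c.
  apply/funext => i; rewrite /upd; case: (eqVneq i k) => // ->.
  by rewrite eq_sym (negPf jk).
have atj : bracket (upd (upd a j c) k (a j)) = - bracket (upd a k c).
  have -> : upd (upd a j c) k (a j) = upd a k c \o tperm k j.
    apply/funext => i; rewrite /upd /=; case: tpermP => [->|->|].
    - by rewrite eqxx (negPf jk).
    - by rewrite (negPf jk) !eqxx.
    - by move=> /eqP/negPf -> /eqP/negPf ->.
  by rewrite bracket_tperm // eq_sym.
have := fundamental_at a (upd a j c) k; rewrite zero => ->.
(* The terms i <> j, k vanish: a_i occurs twice in the inner bracket. *)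
rewrite (bigD1 k) //= (bigD1 j) //= big1 => [|i /andP[ik ij]].
  by rewrite addr0 atk atj -[- bracket (upd a k c)]scaleN1r bracketZ scaleN1r.
have -> : bracket (upd (upd a j c) k (a i)) = 0; last exact: bracket0.
by apply: (@bracket_alt _ _ L _ i k) => //; rewrite updE !upd_neq.
Qed.

End Brackets.

(** * The determinantal n-Lie algebra *)

Section RowReplacement.
Context (R : comNzRingType) (n : nat).
Implicit Types (M : 'M[R]_n) (u : 'I_n -> R).

Definition replace_row i u M : 'M[R]_n :=
  \matrix_(k, l) if k == i then u l else M k l.

Lemma det_replace_row i u M :
  \det (replace_row i u M) = \sum_l u l * cofactor M i l.
Proof.
rewrite (expand_det_row _ i); apply: eq_bigr => l _; rewrite mxE eqxx.
congr (_ * (_ * \det _)); apply/matrixP => j k.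
by rewrite !mxE eq_sym (negPf (neq_lift _ _)).
Qed.

(** Cramer's rule, by rows: replacing each row of M in turn by u gives the
coefficients that express (det M) u in terms of the rows. *)
Lemma cramer_rows u M l :
  \sum_i \det (replace_row i u M) * M i l = \det M * u l.
Proof.
transitivity (\sum_k u k * (\adj M *m M) k l).
  under [RHS]eq_bigr => k _ do rewrite mxE mulr_sumr.
  rewrite exchange_big /=; apply: eq_bigr => i _; rewrite det_replace_row.
  rewrite mulr_suml; apply: eq_bigr => k _.
  by rewrite -mulrA [(\adj M) k i]mxE.
rewrite mul_adj_mx (bigD1 l) //= big1 ?addr0 => [|k kl].
  by rewrite !mxE eqxx mulr1n mulrC.
by rewrite !mxE (negPf kl) mulr0n mulr0.
Qed.

End RowReplacement.

(** The factor K^n carries the images of generators and K[t] all their brackets.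
The parameters n_gt1 and theta only select the n-Lie structure declared below. *)
Definition det_nlie n (n_gt1 : (1 < n)%N) (K : fieldType) (theta : 'I_n -> K) :
  Type := ('rV[K]_n * {poly K})%type.

Section Model.
Context (n : nat) (n_gt1 : (1 < n)%N) (K : fieldType) (theta : 'I_n -> K).

Local Notation det_nlie := (det_nlie n_gt1 theta).

HB.instance Definition _ := GRing.Lmodule.on det_nlie.

Implicit Types (e : det_nlie) (x y : 'I_n -> det_nlie).

(** The pair (v, f) is read as the vector v + f t theta over K[t]. *)
Definition det_row e (l : 'I_n) : {poly K} :=
  (e.1 0 l)%:P + e.2 * ((theta l)%:P * 'X).

Definition det_mat x : 'M[{poly K}]_n := \matrix_(i, l) det_row (x i) l.

Definition det_bracket x : det_nlie := (0, \det (det_mat x)).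

Lemma det_row_linear l : linear (det_row^~ l : det_nlie -> {poly K}).
Proof.
move=> a e e'; rewrite /det_row /= !mxE polyCD polyCM -!mul_polyC mulrDl mulrDr.
by rewrite -!mulrA addrACA.
Qed.

Lemma det_mat_upd x i e :
  det_mat (upd x i e) = replace_row i (det_row e) (det_mat x).
Proof. by apply/matrixP => k l; rewrite !mxE /upd; case: eqP. Qed.

(** The pair (0, h) is read as the row h t theta, so h t factors out of the
determinant. *)
Lemma det_bracket_pure x i h :
  det_bracket (upd x i (0, h)) =
  (0, h * 'X * \det (replace_row i (fun l => (theta l)%:P) (det_mat x))).
Proof.
rewrite /det_bracket det_mat_upd !det_replace_row mulr_sumr.
congr (0, _); apply: eq_bigr => l _; rewrite /det_row /= mxE polyC0 add0r.
by rewrite [_%:P * 'X]mulrC !mulrA.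
Qed.

Fact det_linear x i : linear (fun e => det_bracket (upd x i e)).
Proof.
move=> a e e'; rewrite /det_bracket !det_mat_upd !det_replace_row.
apply/pair_equal_spec; split; first by rewrite /= scaler0 addr0.
rewrite /= scaler_sumr -big_split /=; apply: eq_bigr => l _.
by rewrite (det_row_linear l) mulrDl scalerAl.
Qed.

Fact det_alt x i j : i != j -> x i = x j -> det_bracket x = 0.
Proof.
move=> ij xij; congr (0, _); apply: (determinant_alternate ij) => l.
by rewrite !mxE xij.
Qed.

Let i0 : 'I_n := Ordinal (ltnW n_gt1).

(** By det_bracket_pure both sides are multiples of t, and they agree because the
linear form det(-, y_2, ..., y_n) is applied to the two sides of Cramer's rule
for the row theta. *)
Fact det_fundamental x y :
  det_bracket (hd (det_bracket x) y) =
  \sum_(i < n) det_bracket (upd x i (det_bracket (hd (x i) y))).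
Proof.
have hdE e : hd e y = upd y i0 e.
  by apply/funext => j; rewrite /hd /upd -[0%N]/(val i0) (inj_eq val_inj).
rewrite hdE det_bracket_pure.
under eq_bigr => i _ do rewrite hdE det_bracket_pure.
rewrite -(big_morph (fun f => (0, f) : det_nlie) (id1 := 0) (op1 := +%R)
    (id2 := 0) (op2 := +%R)) //;
  last by move=> f g; apply/pair_equal_spec; rewrite /= addr0.
congr (0, _); rewrite det_replace_row mulr_sumr.
transitivity (\sum_i \sum_l (\det (replace_row i (fun l => (theta l)%:P)
  (det_mat x)) * det_mat x i l) * ('X * cofactor (det_mat y) i0 l)).
  rewrite exchange_big /=; apply: eq_bigr => l _.
  by rewrite -mulr_suml cramer_rows; ring.
apply: eq_bigr => i _; rewrite det_mat_upd.
rewrite [\det (replace_row i0 _ _)]det_replace_row !mulr_suml.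
apply: eq_bigr => l _; rewrite mxE.
by rewrite -/(det_row _ _); ring.
Qed.

HB.instance Definition _ := Lmodule_isNLie.Build n K det_nlie
  n_gt1 det_linear det_alt det_fundamental.

End Model.

Section ModelComputations.
Context (n : nat) (n_gt1 : (1 < n)%N) (K : fieldType) (theta : 'I_n -> K).
Local Notation E := (det_nlie n_gt1 theta).
Implicit Types (x : 'I_n -> E) (h : {poly K}).

(** The ideals (0, t^k K[t]) of the model, which measure how deep an element is. *)
Definition order_ge k : set E := [set e | exists h, e = (0, h * 'X^k)].

Lemma order_ge_subspace k : is_subspace (order_ge k).
Proof.
split=> [|a _ _ [h ->] [h' ->]]; first by exists 0; rewrite mul0r.
exists (a *: h + h'); apply/pair_equal_spec; split => /=.
  by rewrite scaler0 addr0.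
by rewrite mulrDl scalerAl.
Qed.

Lemma order_ge_bracket k x i : order_ge k (x i) -> order_ge k.+1 (bracket x).
Proof.
case=> h xi; rewrite -(upd_same x i) xi [bracket _]det_bracket_pure.
by rewrite -(mulrA h) -exprSr mulrAC; eexists.
Qed.

Lemma order_ge_comm (F : nLieType n K) (g : nlieHom F E) (I : ideal F) k :
  (forall r, ideal_set I r -> order_ge k (g r)) ->
  forall r, ideal_set (comm_ideal I) r -> order_ge k.+1 (g r).
Proof.
move=> gI; apply: comm_ideal_ind => [|y Iy].
  split=> [|a u v gu gv]; rewrite /= ?linear0 ?linearP.
    by case: (order_ge_subspace k.+1).
  by case: (order_ge_subspace k.+1) => _; apply.
by rewrite /= nlieHomP; apply: order_ge_bracket; apply: gI Iy.
Qed.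

(** These tuples are the lifts of the basis x_1, ..., x_n of H under the
homomorphism det_proj below, whence the constant terms 0. Their matrix is the
identity modulo t. *)
Definition basis_lift x : Prop :=
  forall k, (x k).1 = delta_mx 0 k /\ (x k).2.[0] = 0.

Lemma basis_lift_eval0 x k l :
  basis_lift x -> (det_mat x k l).[0] = (k == l)%:R.
Proof.
move=> /(_ k) [xk1 xk2]; rewrite mxE /det_row xk1.
rewrite !(hornerD, hornerC, hornerM) xk2 mul0r addr0.
by rewrite !mxE /= eq_sym.
Qed.

Lemma horner0_det (M : 'M[{poly K}]_n) :
  (\det M).[0] = \det (\matrix_(i, j) (M i j).[0]).
Proof.
rewrite -[LHS]/(horner_eval 0 (\det M)) -det_map_mx; congr (\det _).
by apply/matrixP => i j; rewrite !mxE.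
Qed.

Lemma basis_lift_bracket x : basis_lift x ->
  exists h, bracket x = (0, h) /\ h.[0] = 1.
Proof.
move=> x_lift; exists (\det (det_mat x)); split=> //; rewrite horner0_det.
rewrite (_ : \matrix_(i, j) _ = 1%:M) ?det1 //.
by apply/matrixP => i j; rewrite mxE basis_lift_eval0 // mxE.
Qed.

Lemma basis_lift_bracket_upd x : basis_lift x ->
  exists q : 'I_n -> {poly K}, (forall j, (q j).[0] = theta j) /\
    forall j h, bracket (upd x j (0, h)) = (0, h * 'X * q j).
Proof.
move=> x_lift; exists (fun j => \det (replace_row j (fun l => (theta l)%:P)
  (det_mat x))); split=> [j|j h]; last exact: det_bracket_pure.
rewrite horner0_det.
rewrite (_ : \matrix_(i, l) _ = replace_row j theta 1%:M); last first.
  apply/matrixP => i l; rewrite !mxE; case: eqP => _; first by rewrite hornerC.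
  by have := basis_lift_eval0 i l x_lift; rewrite !mxE.
rewrite det_replace_row.
have adjE l : cofactor (1%:M : 'M[K]_n) j l = (\adj (1%:M : 'M[K]_n)) l j.
  by rewrite mxE.
under eq_bigr => l _ do rewrite adjE adj1 mxE.
by rewrite (bigD1 j) //= big1 ?addr0 ?eqxx ?mulr1 // => l /negPf ->; rewrite mulr0.
Qed.

End ModelComputations.

(** * Structure of the Heisenberg algebra *)

Section HeisenbergBasis.
Context n (K : fieldType) (H : nLieType n K).
Implicit Types (x : 'I_n -> H) (z : H).

Lemma center_bracket z x i : center H z -> x i = z -> bracket x = 0.
Proof.
move=> zC xi; have [e -> _] := bracket_to_first x i.
have := zC (x \o tperm i (ord_fst H)); rewrite hdE.
suff -> : upd (x \o tperm i (ord_fst H)) (ord_fst H) z = x \o tperm i (ord_fst H).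
  by move=> ->; rewrite scaler0.
by rewrite -[RHS](upd_same _ (ord_fst H)) /= tpermR xi.
Qed.

Definition combination x z (v : 'rV[K]_n) (a : K) : H :=
  \sum_j v 0 j *: x j + a *: z.

Lemma combinationP x z c v a v' a' :
  combination x z (c *: v + v') (c * a + a') =
  c *: combination x z v a + combination x z v' a'.
Proof.
rewrite /combination scalerDr scaler_sumr addrACA -big_split /= scalerA -scalerDl.
by congr (_ + _); apply: eq_bigr => j _; rewrite !mxE scalerDl scalerA.
Qed.

(** An alternating multilinear map on K^n is a multiple of the determinant; the
components along the central element z do not contribute. *)
Lemma bracket_combination x z (e : 'I_n -> 'rV[K]_n * K^o) : center H z ->
  bracket (fun i => combination x z (e i).1 (e i).2) =
  \det (\matrix_(i, j) (e i).1 0 j) *: bracket x.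
Proof.
move=> zC; pose comb (e : 'rV[K]_n * K^o) := combination x z e.1 e.2.
pose mat (e : 'I_n -> 'rV[K]_n * K^o) := \matrix_(i, j) (e i).1 0 j.
pose Q e := bracket (comb \o e) = \det (mat e) *: bracket x.
have comb_upd f i a : comb \o upd f i a = upd (comb \o f) i (comb a).
  by apply/funext => j; rewrite /= /upd; case: eqP.
have mat_upd f i a : mat (upd f i a) = replace_row i (fun l => a.1 0 l) (mat f).
  by apply/matrixP => k l; rewrite !mxE /upd; case: eqP.
have comb_lin c u v : comb (c *: u + v) = c *: comb u + comb v.
  exact: combinationP.
pose G := [set (delta_mx 0 j, 0) | j in [set: 'I_n]] `|` [set (0, 1)]
  : set ('rV[K]_n * K^o).
apply: (@multilinear_ind K _ n (fun=> G) Q); rewrite /Q.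
- move=> f i; split=> [|c u v].
    rewrite /= comb_upd mat_upd det_replace_row big1 => [|l _]; last first.
      by rewrite mxE mul0r.
    rewrite scale0r; apply: (upd_bracket0 (i := i)); rewrite updE.
    rewrite /comb /combination /= scale0r addr0 big1 // => j _.
    by rewrite mxE scale0r.
  rewrite /= !comb_upd !mat_upd !det_replace_row => Hu Hv.
  rewrite comb_lin bracketP Hu Hv scalerA -scalerDl.
  rewrite mulr_sumr -big_split /=; congr (_ *: _); apply: eq_bigr => l _.
  by rewrite !mxE mulrDl mulrA.
- move=> f fG.
  have [[i fi]|f1] := pselect (exists i, f i = (0, 1)).
    rewrite (@center_bracket z _ i) //; last first.
      rewrite /= /comb fi /combination /= scale1r big1 ?add0r // => j _.
      by rewrite mxE scale0r.
    rewrite (expand_det_row _ i) big1 ?scale0r // => j _.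
    by rewrite mxE fi mxE mul0r.
  have /choice [s fE] : forall i, exists j, f i = (delta_mx 0 j, 0).
    move=> i; case: (fG i) => [[j _ <-]|fi]; first by exists j.
    by case: f1; exists i.
  have -> : comb \o f = x \o s.
    apply/funext => i; rewrite /= fE /comb /combination /= scale0r addr0.
    rewrite (bigD1 (s i)) //= big1 ?addr0; last first.
      by move=> j /negPf js; rewrite mxE js andbF scale0r.
    by rewrite mxE !eqxx scale1r.
  have [/injectiveP s_inj|/injectivePn [i [j ij sij]]] := boolP (injectiveb s).
    have -> : mat f = perm_mx (perm s_inj).
      by apply/matrixP => i j; rewrite !mxE fE mxE permE /= eq_sym.
    rewrite det_perm -bracket_perm; congr bracket.
    by apply/funext => i /=; rewrite permE.
  rewrite (bracket_noninj _ ij) // (determinant_alternate ij) ?scale0r // => l.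
  by rewrite !mxE !fE sij.
(* Every pair is a combination of the generators in G. *)
move=> i; case: (e i) => v a.
have -> : (v, a) = \sum_j v 0 j *: ((delta_mx 0 j, 0) : 'rV[K]_n * K^o) +
    a *: ((0, 1) : 'rV[K]_n * K^o).
  apply: injective_projections; rewrite /= ?raddf_sum /=.
    by rewrite scaler0 addr0 {1}[v]row_sum_delta; apply: eq_bigr.
  by rewrite big1 ?add0r ?[RHS]mulr1 // => j _; rewrite scaler0.
have S_sub := lin_span_subspace G.
apply: (subspaceD S_sub).
  apply: subspace_sum => [|j _]; first exact: S_sub.
  apply: (subspaceZ _ S_sub).
  by apply: sub_gen_smallest; left; exists j.
by apply: (subspaceZ _ S_sub); apply: sub_gen_smallest; right.
Qed.

(** The algebra H is spanned by the line L^2 = Z(L) and n further elements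
x_1, ..., x_n. By bracket_combination every bracket is a multiple of
[x_1, ..., x_n], so this bracket cannot vanish and spans L^2. *)
Lemma heisenberg_basis : heisenberg H -> has_dim [set: H] n.+1 ->
  exists x, [/\ center H (bracket x),
    forall h, exists v a, h = combination x (bracket x) v a &
    forall v a, combination x (bracket x) v a = 0 -> v = 0 /\ a = 0].
Proof.
case=> lcs2C [b [b_free b_span]] [e [e_free e_span]].
pose z := b ord0; have lcs2P u : ideal_set (lcs H 2) u <-> exists a, u = a *: z.
  rewrite b_span; split=> [[c _ <-]|[a ->]].
    by exists (c ord0); rewrite big_ord1.
  by exists (fun=> a) => //; rewrite big_ord1.
have zC : center H z.
  by rewrite -lcs2C; apply/lcs2P; exists 1; rewrite scale1r.
have z_neq0 : z != 0.
  apply/eqP => z0; have b1 : \sum_i 1 *: b i = 0.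
    by rewrite big_ord1 -/z z0 scaler0.
  by have /eqP := b_free _ b1 ord0; rewrite oner_eq0.
(* The central vector z replaces a basis vector e_k in which it has a non-zero
   coordinate; the remaining e_i are the x_j. *)
have [c zE] : exists c, z = \sum_i c i *: e i.
  by have : [set: H] z by []; rewrite e_span => -[c _ <-]; exists c.
have [k ck] : exists k, c k != 0.
  apply: contrapT => c0; case/eqP: z_neq0; rewrite zE big1 // => i _.
  by have [->|ci] := eqVneq (c i) 0; [rewrite scale0r|case: c0; exists i].
pose x j := e (lift k j).
have x_span h : exists v a, h = combination x z v a.
  have : [set: H] h by []; rewrite e_span => -[d _ <-].
  exists (\row_j (d (lift k j) - d k / c k * c (lift k j))), (d k / c k).
  rewrite /combination zE scaler_sumr !(bigD1_ord k) //= addrCA scalerA divfK //.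
  congr (_ + _); rewrite -big_split /=; apply: eq_bigr => j _.
  by rewrite mxE scalerBl scalerA subrK.
have x_free v a : combination x z v a = 0 -> v = 0 /\ a = 0.
  move=> xz0; pose d i := (if unlift k i is Some j then v 0 j else 0) + a * c i.
  have d0 : forall i, d i = 0.
    apply: e_free; rewrite -[RHS]xz0 /combination zE scaler_sumr !(bigD1_ord k) //=.
    rewrite /d unlift_none add0r -scalerA [RHS]addrCA; congr (_ + _).
    rewrite -big_split /=; apply: eq_bigr => j _.
    by rewrite liftK scalerDl scalerA.
  have a0 : a = 0.
    have := d0 k; rewrite /d unlift_none add0r => /eqP.
    by rewrite mulf_eq0 (negPf ck) orbF => /eqP.
  split=> //; apply/rowP => j; have := d0 (lift k j).
  by rewrite /d liftK a0 mul0r addr0 mxE.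
have bx_neq0 : bracket x <> 0.
  move=> bx0; have : ideal_set (lcs H 2) z.
    by apply/lcs2P; exists 1; rewrite scale1r.
  suff: ideal_set (lcs H 2) `<=` [set 0] by move=> /[apply]; apply/eqP.
  apply: comm_ideal_ind => [|f _]; first exact: subspace0.
  have /choice [g gE] : forall i, exists p : 'rV[K]_n * K^o,
      f i = combination x z p.1 p.2.
    by move=> i; have [v [a ->]] := x_span (f i); exists (v, a).
  by rewrite /= (funext gE) bracket_combination // bx0 scaler0.
have [a bxE] : exists a, bracket x = a *: z.
  by apply/lcs2P; apply: (comm_bracket (I := idealT H) (i := ord_fst H)).
have a_neq0 : a != 0 by apply/eqP => a0; apply: bx_neq0; rewrite bxE a0 scale0r.
have combE v d : combination x (bracket x) v d = combination x z v (d * a).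
  by rewrite /combination bxE scalerA.
exists x; split=> [|h|v d].
- by rewrite -lcs2C; apply/lcs2P; exists a.
- have [v [d ->]] := x_span h; exists v, (d / a).
  by rewrite combE divfK.
- rewrite combE => /x_free [-> /eqP]; rewrite mulf_eq0 (negPf a_neq0) orbF.
  by move/eqP.
Qed.

End HeisenbergBasis.

(** * Generators of the third term of the lower central series *)

Section Spanning.
Context n (K : fieldType) (F : nLieType n K) (a : 'I_n -> F).

(** Numbered by the term of the lower central series that contains them. *)
Definition weight3 j : F := bracket (upd a j (bracket a)).
Definition weight4 j k : F := bracket (upd a k (weight3 j)).

Lemma weight4C j k : weight4 j k = weight4 k j.
Proof. exact: iterated_bracketC. Qed.

(** This is the form in which the elements w_j and w_jk come out of the
multilinear expansions below. *)
Lemma bracket_mostly_generators x i :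
  (forall k, k != i -> exists j, x k = a j) ->
  exists k (e : K), bracket x = e *: bracket (upd a k (x i)).
Proof.
move=> xa; have /choice [f fE] : forall k, exists j, k != i -> x k = a j.
  move=> k; have [_|/xa [j]] := eqVneq k i; first by exists i.
  by exists j.
have [k [e bE]] := bracket_reindex_upd a f i (x i); exists k, e; rewrite -bE.
by congr bracket; apply/funext => j; rewrite /upd; case: eqP => [->|/eqP/fE].
Qed.

Context (R : ideal F).
Let c : F := bracket a.
Context (F_span : forall u, exists (v : 'I_n -> K) e r,
  ideal_set R r /\ u = \sum_j v j *: a j + e *: c + r).
Context (weight3_R : forall j, ideal_set R (weight3 j)).

Let gens : set F := [set a j | j in setT] `|` [set c] `|` R.

Let gens_span u : lin_span gens u.
Proof.
have S_sub := lin_span_subspace gens.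
have [v [e [r [Rr ->]]]] := F_span u.
apply: (subspaceD S_sub); last by apply: sub_gen_smallest; right.
apply: (subspaceD S_sub).
  apply: subspace_sum => [|j _]; first exact: S_sub.
  apply: (subspaceZ _ S_sub).
  by apply: sub_gen_smallest; left; left; exists j.
by apply: (subspaceZ _ S_sub); apply: sub_gen_smallest; left; right.
Qed.

Let lcs2_gens : set F :=
  [set c] `|` [set weight3 j | j in setT] `|` comm_ideal R.

(** A bracket of generators falls into [R, F, ..., F] as soon as one entry is in
R. Otherwise it vanishes unless c occurs at most once, and then the entries a_j
fill the other places. *)
Lemma lcs2_span : ideal_set (lcs F 2) `<=` lin_span lcs2_gens.
Proof.
have S_sub := lin_span_subspace lcs2_gens.
apply: comm_ideal_ind => // x _.
apply: (@multilinear_ind K F n (fun=> gens)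
  (fun x => lin_span lcs2_gens (bracket x))) => [{}x i|{}x xG|i].
- exact: bracket_subspace.
- have [[i Ri]|xR] := pselect (exists i, ideal_set R (x i)).
    by apply: sub_gen_smallest; right; apply: comm_bracket Ri.
  have {xR}xG i : (exists j, x i = a j) \/ x i = c.
    case: (xG i) => [[[j _ <-]|->]|Ri]; [by left; exists j|by right|].
    by case: xR; exists i.
  have [[i xi]|xc] := pselect (exists i, x i = c); last first.
    have /choice [f fE] : forall i, exists j, x i = a j.
      by move=> i; case: (xG i) => // xi; case: xc; exists i.
    have [e bE] := bracket_reindex a f; rewrite (funext fE : x = a \o f) bE.
    by apply: (subspaceZ _ S_sub); apply: sub_gen_smallest; left; left.
  have [[k [ki xk]]|xa] := pselect (exists k, k != i /\ x k = c).
    by rewrite (@bracket_alt _ _ F _ k i) // ?xi //; case: S_sub.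
  have [k ki|k [e ->]] := @bracket_mostly_generators x i.
    by case: (xG k) => // xk; case: xa; exists k.
  apply: (subspaceZ _ S_sub); apply: sub_gen_smallest; left; right.
  by exists k; rewrite // xi.
exact: gens_span.
Qed.

(** The first entry runs over the generators of F^2 found above, the others over
those of F. An entry in [R, F, ..., F], or a pair of entries in F^2 and R, leads
into gamma_3(R); both c and w_j are in F^2, and w_j is in R as well. The
remaining brackets have entries a_j everywhere but in the first place. *)
Lemma lcs3_span (P : set F) : is_subspace P ->
  (forall j, P (weight3 j)) -> (forall j k : 'I_n, (j <= k)%N -> P (weight4 j k)) ->
  ideal_set (gamma3 R) `<=` P -> ideal_set (lcs F 3) `<=` P.
Proof.
move=> P_sub P3 P4' PR.
have P4 j k : P (weight4 j k).
  by have [jk|/ltnW kj] := leqP j k; [|rewrite weight4C]; apply: P4'.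
have c_lcs2 : ideal_set (lcs F 2) c.
  by apply: (comm_bracket (I := idealT F) (i := ord_fst F)).
have w_lcs2 j : ideal_set (lcs F 2) (weight3 j).
  by apply: (comm_bracket (I := idealT F) (i := ord_fst F)).
pose i0 := ord_fst F.
apply: comm_ideal_ind => // x x2.
apply: (@multilinear_ind K F n (fun i => if i == i0 then lcs2_gens else gens)
  (fun x => P (bracket x))) => [y i|{x x2}x xG|i]; first exact: bracket_subspace.
  have mixed i j : i != j -> ideal_set (lcs F 2) (x i) -> ideal_set R (x j) ->
      P (bracket x).
    by move=> ij xi xj; apply: PR; apply: comm2_bracket ij xi xj.
  have xG' k : k != i0 -> [\/ exists j, x k = a j, x k = c | ideal_set R (x k)].
    move=> /negPf ki; have := xG k; rewrite ki => -[[[j _ <-]|->]|Rk].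
    - by apply: Or31; exists j.
    - exact: Or32.
    - exact: Or33.
  (* some later entry is in R *)
  have [[k [ki Rk]]|xR] := pselect (exists k, k != i0 /\ ideal_set R (x k)).
    case: (xG i0 : lcs2_gens (x i0)) => [[xc|[l _ xw]]|g2].
    - by apply: (mixed i0 k); rewrite 1?eq_sym // xc.
    - by apply: (mixed i0 k); rewrite 1?eq_sym // -xw.
    - by apply: PR; apply: comm_bracket g2.
  have {}xR k : k != i0 -> (exists j, x k = a j) \/ x k = c.
    by move=> ki; case: (xG' k ki) => [|| Rk]; [left|right|case: xR; exists k].
  (* some later entry is c *)
  have [[k [ki xk]]|xc] := pselect (exists k, k != i0 /\ x k = c).
    case: (xG i0 : lcs2_gens (x i0)) => [[xc|[l _ xw]]|g2].
    - by rewrite (@bracket_alt _ _ F _ k i0) // ?xk //; case: P_sub.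
    - by apply: (mixed k i0); rewrite // ?xk // -xw.
    - by apply: PR; apply: comm_bracket g2.
  have [k ki|k [e]] := @bracket_mostly_generators x i0.
    by case: (xR k ki) => // xk; case: xc; exists k.
  case: (xG i0 : lcs2_gens (x i0)) => [[->|[l _ <-]]|g2] bE.
  - by rewrite bE; apply: (subspaceZ _ P_sub); apply: P3.
  - by rewrite bE; apply: (subspaceZ _ P_sub); apply: P4.
  - by apply: PR; apply: comm_bracket g2.
case: eqP => [->|_]; [exact: lcs2_span|exact: gens_span].
Qed.

End Spanning.

(** * Linear independence modulo gamma_3 *)

Section Projection.
Context n (n_gt1 : (1 < n)%N) (K : fieldType) (theta : 'I_n -> K).
Local Notation E := (det_nlie n_gt1 theta).
Context (H : nLieType n K) (x : 'I_n -> H) (zC : center H (bracket x)).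

(** The quotient of the model onto H: K^n maps onto the span of the x_j, and the
constant terms of K[t] onto the centre. *)
Definition det_proj (e : E) : H := combination x (bracket x) e.1 e.2.[0].

Fact det_proj_linear : linear det_proj.
Proof.
by move=> c u v; rewrite /det_proj /= hornerD hornerZ combinationP.
Qed.

HB.instance Definition _ := GRing.isLinear.Build K E H _ det_proj det_proj_linear.

Lemma det_proj_bracket (f : 'I_n -> E) :
  det_proj (bracket f) = bracket (fun i => det_proj (f i)).
Proof.
rewrite (bracket_combination x (fun i => ((f i).1, (f i).2.[0] : K^o)) zC).
rewrite /det_proj /combination big1 => [|j _]; last by rewrite mxE scale0r.
rewrite add0r /= horner0_det; congr (\det _ *: _); apply/matrixP => i j.
by rewrite !mxE /det_row !(hornerD, hornerC, hornerM, hornerX) !mulr0 addr0.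
Qed.

(** The generators are lifted arbitrarily along det_proj; uniqueness in the
universal property then forces det_proj \o g = p on all of F. *)
Lemma presentation_lift (X : Type) (F : nLieType n K) (iota : X -> F)
    (p : nlieHom F H) :
  (forall h, exists v a, h = combination x (bracket x) v a) -> free_on iota ->
  exists g : nlieHom F E, forall u, det_proj (g u) = p u.
Proof.
move=> x_span F_free.
have /choice [f fE] : forall t, exists e, det_proj e = p (iota t).
  move=> t; have [v [a ->]] := x_span (p (iota t)); exists (v, a%:P).
  by rewrite /det_proj /= hornerC.
have [[g gE] _] := F_free _ f; exists g.
have comp_bracket y :
    (det_proj \o g) (bracket y) = bracket (fun i => (det_proj \o g) (y i)).
  by rewrite /= nlieHomP det_proj_bracket.
pose q := NLieHom comp_bracket.
have [_ uniq] := F_free _ (p \o iota).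
by apply: (uniq q p) => // t; rewrite /= gE fE.
Qed.

End Projection.

Section Independence.
Context n (K : fieldType) (H : nLieType n K) (x : 'I_n -> H).
Context (zC : center H (bracket x))
  (x_span : forall h, exists v a, h = combination x (bracket x) v a)
  (x_free : forall v a, combination x (bracket x) v a = 0 -> v = 0 /\ a = 0).
Context (X : Type) (F : nLieType n K) (iota : X -> F) (F_free : free_on iota).
Context (p : nlieHom F H) (a : 'I_n -> F) (pa : forall i, p (a i) = x i).

Section FixedTheta.
Context (theta : 'I_n -> K).
Local Notation E := (det_nlie (@arity_gt1 _ _ H) theta).
Context (g : nlieHom F E) (gE : forall u, det_proj x (g u) = p u).

(** The map det_proj is injective on pairs with constant second component, so an
element of the kernel of p goes to a pair (0, f) with f(0) = 0. *)
Lemma ker_order_ge r : ideal_set (ker p) r -> order_ge 1 (g r).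
Proof.
rewrite /= /ker_set /= -gE => /x_free; case: (g r) => v f /= [-> f0].
have /factor_theorem [h ->] : root f 0 by apply/eqP.
by exists h; rewrite subr0 expr1.
Qed.

Lemma lift_is_basis_lift : basis_lift (g \o a).
Proof.
move=> k; have : det_proj x (g (a k)) - x k = 0 by rewrite gE pa subrr.
have -> : x k = combination x (bracket x) (delta_mx 0 k) 0.
  rewrite /combination scale0r addr0 (bigD1 k) //= big1 => [|j /negPf jk].
    by rewrite mxE !eqxx scale1r addr0.
  by rewrite mxE jk andbF scale0r.
rewrite /det_proj addrC -scaleN1r -combinationP => /x_free [].
rewrite mulr0 add0r scaleN1r addrC => /eqP; rewrite subr_eq0 => /eqP.
by [].
Qed.

Lemma lift_bracket_upd j u :
  g (bracket (upd a j u)) = bracket (upd (g \o a) j (g u)).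
Proof.
rewrite nlieHomP; congr bracket; apply/funext => i.
by rewrite /= /upd; case: eqP.
Qed.

(** The image of a relation under g is t f (A + t B) = t^3 h with f(0) = 1, where
A and B have constant terms sum alpha_j theta_j and sum beta_t theta_j theta_k.
The coefficient of t gives the first claim. The coefficient of t^2 also involves
A, which disappears once all alpha_j are known to vanish. *)
Lemma weights_independent_at (T : finType) (s : T -> 'I_n * 'I_n)
    (alpha : 'I_n -> K) (beta : T -> K) :
  ideal_set (gamma3 (ker p)) (\sum_j alpha j *: weight3 a j +
    \sum_t beta t *: weight4 a (s t).1 (s t).2) ->
  \sum_j alpha j * theta j = 0 /\
  ((forall j, alpha j = 0) -> \sum_t beta t * (theta (s t).1 * theta (s t).2) = 0).
Proof.
have [f [gc f0]] := basis_lift_bracket lift_is_basis_lift.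
have [q [q0 gq]] := basis_lift_bracket_upd lift_is_basis_lift.
have g3 j : g (weight3 a j) = (0, f * 'X * q j).
  by rewrite lift_bracket_upd nlieHomP gc gq.
have g4 j k : g (weight4 a j k) = (0, f * 'X * q j * 'X * q k).
  by rewrite lift_bracket_upd g3 gq.
have snd_sum (S : finType) (e : S -> E) : (\sum_i e i).2 = \sum_i (e i).2.
  by apply: (big_morph (fun u : E => u.2)).
move=> /(order_ge_comm (order_ge_comm ker_order_ge)) [h].
rewrite linearD !linear_sum => /(congr1 snd) /=.
rewrite !snd_sum.
have gZ c u : g (c *: u) = c *: g u by exact: linearZ_LR.
under [X in X + _ = _ -> _]eq_bigr => j _ do rewrite gZ g3.
under [X in _ + X = _ -> _]eq_bigr => t _ do rewrite gZ g4.
pose A := \sum_j alpha j *: q j.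
pose B := \sum_t beta t *: (q (s t).1 * q (s t).2).
rewrite (_ : \sum_j _ = f * 'X * A); last first.
  by rewrite mulr_sumr; apply: eq_bigr => j _; rewrite /= scalerAr.
rewrite (_ : \sum_t _ = f * 'X * 'X * B); last first.
  rewrite mulr_sumr; apply: eq_bigr => t _; rewrite /= -!scalerAr; congr (_ *: _).
  by ring.
have A0 : A.[0] = \sum_j alpha j * theta j.
  by rewrite horner_sum; apply: eq_bigr => j _; rewrite hornerZ q0.
have B0 : B.[0] = \sum_t beta t * (theta (s t).1 * theta (s t).2).
  by rewrite horner_sum; apply: eq_bigr => t _; rewrite hornerZ hornerM !q0.
move=> rel; have X_neq0 : 'X != 0 :> {poly K} by rewrite polyX_eq0.
have relA : f * (A + 'X * B) = h * 'X^2.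
  by apply: (mulfI X_neq0); rewrite [RHS]mulrCA -exprS -rel; ring.
rewrite -A0 -B0; split=> [|alpha0].
  have := congr1 (fun u => u.[0]) relA.
  rewrite !(hornerM, hornerD, hornerX, hornerXn) f0 mul1r mul0r addr0 => ->.
  by rewrite !mulr0.
have A_eq0 : A = 0 by apply: big1 => j _; rewrite alpha0 scale0r.
have relB : f * B = h * 'X.
  apply: (mulfI X_neq0); rewrite [RHS]mulrCA -expr2 -relA A_eq0.
  ring.
have := congr1 (fun u => u.[0]) relB.
by rewrite !(hornerM, hornerX) f0 mul1r mulr0.
Qed.

End FixedTheta.

(** The unit vectors theta = e_j yield alpha_j = 0 and the diagonal coefficients
beta; with these gone, theta = e_j + e_k isolates the coefficient of w_jk. *)
Lemma weights_independent (T : finType) (s : T -> 'I_n * 'I_n)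
    (alpha : 'I_n -> K) (beta : T -> K) :
  injective s -> (forall t, ((s t).1 <= (s t).2)%N) ->
  ideal_set (gamma3 (ker p)) (\sum_j alpha j *: weight3 a j +
    \sum_t beta t *: weight4 a (s t).1 (s t).2) ->
  (forall j, alpha j = 0) /\ (forall t, beta t = 0).
Proof.
move=> s_inj s_le rel.
have rel_at theta := let: ex_intro g gE :=
  presentation_lift (@arity_gt1 _ _ H) theta zC p x_span F_free in
  weights_independent_at gE rel.
pose unit j (i : 'I_n) : K := (i == j)%:R.
have alpha0 j : alpha j = 0.
  have [<- _] := rel_at (unit j).
  rewrite (bigD1 j) //= big1 /unit ?addr0 ?eqxx ?mulr1 // => i /negPf ->.
  by rewrite mulr0.
split=> // t.
have quad0 theta : \sum_t beta t * (theta (s t).1 * theta (s t).2) = 0.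
  by have [_ ->] := rel_at theta.
have neq_s u v : u != v -> ((s u).1 != (s v).1) || ((s u).2 != (s v).2).
  move=> uv; rewrite -negb_and; apply: contra uv => /andP[/eqP E1 /eqP E2].
  by apply/eqP/s_inj; rewrite (surjective_pairing (s u)) E1 E2 -surjective_pairing.
have diag0 u : (s u).1 = (s u).2 -> beta u = 0.
  move=> su; rewrite -[RHS](quad0 (unit (s u).1)).
  rewrite (bigD1 u) //= big1 => [|v vu]; last first.
    rewrite /unit; case/orP: (neq_s _ _ vu) => /negPf E.
      by rewrite E mul0r mulr0.
    by rewrite su E !mulr0.
  by rewrite /unit -su !eqxx !mulr1 addr0.
have [/diag0//|st] := eqVneq (s t).1 (s t).2.
rewrite -[RHS](quad0 (fun i => unit (s t).1 i + unit (s t).2 i)).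
rewrite (bigD1 t) //= big1 => [|u ut]; last first.
  have [/diag0 ->|su] := eqVneq (s u).1 (s u).2; first by rewrite mul0r.
  have lt_s v : (s v).1 != (s v).2 -> ((s v).1 < (s v).2)%N.
    by move=> sv; rewrite ltn_neqAle sv s_le.
  have ltu := lt_s _ su; have ltt := lt_s _ st.
  rewrite /unit; case: eqP (neq_s _ _ ut) => [u1|_] /= u2.
    rewrite (negPf u2) (_ : (s u).2 == (s t).1 = false) ?addr0 ?mulr0 //.
    by rewrite -u1 eq_sym (negPf su).
  case: eqP => [u1|_]; last by rewrite addr0 mul0r mulr0.
  rewrite (_ : (s u).2 == (s t).1 = false); last first.
    by apply: contraTF ltu => /eqP ->; rewrite u1 -leqNgt ltnW.
  rewrite (_ : (s u).2 == (s t).2 = false) ?addr0 ?mulr0 //.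
  by rewrite -u1 eq_sym (negPf su).
rewrite /unit !eqxx (negPf st) eq_sym (negPf st).
by rewrite !addr0 add0r !mulr1.
Qed.

End Independence.

(** * The multiplier *)

Lemma abelian_isog n (n_gt1 : (1 < n)%N) (K : fieldType) (Q : nLieType n K)
    (T : finType) (b : T -> Q) :
  (forall x : 'I_n -> Q, bracket x = 0) ->
  (forall c : T -> K, \sum_t c t *: b t = 0 -> forall t, c t = 0) ->
  (forall u, exists c : T -> K, u = \sum_t c t *: b t) ->
  nlie_isog Q (abelian_nlie n_gt1 K #|T|).
Proof.
move=> Q0 b_free b_span; pose A := abelian_nlie n_gt1 K #|T|.
pose comb (v : A) := \sum_t v 0 (enum_rank t) *: b t.
have /choice [f fE] : forall u, exists v : A, u = comb v.
  move=> u; have [c ->] := b_span u; exists (\row_i c (enum_val i)).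
  by apply: eq_bigr => t _; rewrite mxE enum_rankK.
have comb_inj v w : comb v = comb w -> v = w.
  move=> /eqP; rewrite -subr_eq0 -sumrB => /eqP vw; apply/rowP => i.
  apply/eqP; rewrite -subr_eq0 -(enum_valK i); apply/eqP.
  apply: (b_free (fun t => v 0 (enum_rank t) - w 0 (enum_rank t))).
  by rewrite -[RHS]vw; apply: eq_bigr => t _; rewrite scalerBl.
have f_lin : linear f.
  move=> c u v; apply: comb_inj; rewrite -fE {1}[u]fE {1}[v]fE /comb.
  rewrite scaler_sumr -big_split /=; apply: eq_bigr => t _.
  by rewrite !mxE scalerDl scalerA.
pose f_hom : {linear Q -> A} := HB.pack f (GRing.isLinear.Build K Q A _ f f_lin).
have f_bracket x : f_hom (bracket x) = bracket (fun i => f_hom (x i)).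
  by rewrite Q0 linear0.
exists (NLieHom f_bracket); exists comb => [u|v]; first by rewrite -fE.
by apply: comb_inj; rewrite -fE.
Qed.

Definition ordered_pair n := {s : 'I_n * 'I_n | (s.1 <= s.2)%N}.

(** The pairs j <= k are counted by k: 1 + ... + n = 'C(n + 1, 2). *)
Lemma card_weights n :
  #|{: 'I_n + ordered_pair n}| = ((n ^ 2 + 3 * n) %/ 2)%N.
Proof.
rewrite card_sum card_ord card_sig.
have -> : #|[pred s : 'I_n * 'I_n | (s.1 <= s.2)%N]| = 'C(n.+1, 2).
  rewrite -sum1_card (eq_bigl (fun s : 'I_n * 'I_n => true && (s.1 <= s.2)%N)) //.
  rewrite -(pair_big_dep xpredT (fun i j : 'I_n => (i <= j)%N) (fun _ _ => 1%N)).
  rewrite (exchange_big_dep xpredT) //= -bin2_sum big_nat_recl // add0n big_mkord.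
  apply: eq_bigr => j _; rewrite -[RHS]card_ord -sum1_card.
  by rewrite (big_ord_widen n (fun=> 1%N) (ltn_ord j)).
rewrite bin2 /= -divn2 -divnMDl // mulSn addnA -mulnSr addnC mulnn.
by rewrite [(n * 3)%N]mulnC.
Qed.

Section Multiplier.
Context n (K : fieldType) (H F : nLieType n K) (p : nlieHom F H).
Let J := idealI (ker p) (lcs F 3).

(** Of the n >= 2 entries, one is in F^3, hence in F^2, and another one is in R. *)
Lemma multiplier2_abelian (x : 'I_n -> multiplier2 p) : bracket x = 0.
Proof.
have [y ->] := quot_lift x; rewrite [bracket _]quot_bracketE -quot_proj0.
apply/quot_projP; rewrite subr0 /=.
have yJ i : ideal_set J (ideal_val (y i)) by apply/ideal_predP/ideal_valP.
pose i0 := ord_fst H; pose i1 := Ordinal (@arity_gt1 _ _ H).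
have i01 : i0 != i1 by [].
apply: (comm2_bracket (I := ker p) i01); last by case: (yJ i1).
by case: (yJ i0) => _; apply: comm_ideal_sub.
Qed.

End Multiplier.

Theorem theorem2p4 (n : nat) (n_ge2 : (2 <= n)%N) (K : fieldType)
    (H : nLieType n K) (H_heis : heisenberg H)
    (H_dim : has_dim [set: H]%classic n.+1)
    (X : Type) (F : nLieType n K) (iota : X -> F) (F_free : free_on iota)
    (p : nlieHom F H) (p_surj : forall h : H, exists x : F, p x = h) :
  nlie_isog (multiplier2 p) (abelian_nlie n_ge2 K ((n ^ 2 + 3 * n) %/ 2)%N).
Proof.
have [x [zC x_span x_free]] := heisenberg_basis H_heis H_dim.
have /choice [a pa] : forall i, exists u, p u = x i by move=> i; apply: p_surj.
have pc : p (bracket a) = bracket x.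
  by rewrite nlieHomP; congr bracket; apply/funext.
have p_upd j u : p (bracket (upd a j u)) = bracket (upd x j (p u)).
  rewrite nlieHomP; congr bracket; apply/funext => i.
  by rewrite /upd; case: eqP.
have p3 j : ideal_set (ker p) (weight3 a j).
  by rewrite /= /ker_set /= p_upd pc (center_bracket (i := j) zC) ?updE.
have p4 j k : ideal_set (ker p) (weight4 a j k).
  by apply: (ideal_bracket (i := k)); rewrite updE.
(* Subtracting from u the lift of the coordinates of p u leaves an element of
   the kernel. *)
have F_span u : exists (v : 'I_n -> K) e r,
    ideal_set (ker p) r /\ u = \sum_j v j *: a j + e *: bracket a + r.
  have [v [e puE]] := x_span (p u); exists (v 0), e.
  exists (u - (\sum_j v 0 j *: a j + e *: bracket a)); split; last first.
    by rewrite addrC subrK.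
  rewrite /= /ker_set /= linearB /= puE linearD /= linearZ /= pc linear_sum /=.
  rewrite (eq_bigr (fun j => v 0 j *: x j)) ?subrr // => j _.
  by rewrite linearZ /= pa.
have l3 j : ideal_set (lcs F 3) (weight3 a j).
  apply: (comm_bracket (I := lcs F 2) (i := j)); rewrite updE.
  by apply: (comm_bracket (I := idealT F) (i := ord_fst F)).
have l4 j k : ideal_set (lcs F 3) (weight4 a j k).
  by apply: (ideal_bracket (i := k)); rewrite updE.
pose J := idealI (ker p) (lcs F 3).
pose b (t : 'I_n + ordered_pair n) : F :=
  match t with inl j => weight3 a j | inr s => weight4 a (val s).1 (val s).2 end.
have bJ t : b t \in ideal_pred J.
  by apply/ideal_predP; case: t => [j|s]; split; [apply: p3|apply: l3|apply: p4|apply: l4].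
pose B t : multiplier2 p := quot_proj _ (IdealType (bJ t)).
have sum_B (c : 'I_n + ordered_pair n -> K) : exists2 u : ideal_type J,
    \sum_t c t *: B t = quot_proj (restrict_ideal J (gamma3 (ker p))) u &
    ideal_val u = \sum_t c t *: b t.
  exists (\sum_t c t *: IdealType (bJ t)).
    by rewrite linear_sum; apply: eq_bigr => t _; rewrite linearZ.
  transitivity (\sum_t ideal_val (c t *: IdealType (bJ t))).
    exact: (raddf_sum (val : ideal_type J -> F)).
  by apply: eq_bigr => t _; exact: (linearZ_LR (val : ideal_type J -> F)).
have split_sum c : \sum_t c t *: b t = \sum_j c (inl j) *: weight3 a j +
    \sum_s c (inr s) *: weight4 a (val s).1 (val s).2.
  exact: big_sumType.
have B_free c : \sum_t c t *: B t = 0 -> forall t, c t = 0.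
  have [u -> uE] := sum_B c; rewrite -quot_proj0 => /quot_projP.
  rewrite subr0 /= uE split_sum.
  move=> /(weights_independent zC x_span x_free F_free pa (s := val) val_inj).
  by case=> [[]|c3 c4 []].
have B_span u : exists c, u = \sum_t c t *: B t.
  rewrite -[u]quot_projK; case: (repr u) => v vJ.
  have /ideal_predP [_ v3] := vJ.
  suff: [set w | exists (c : 'I_n + ordered_pair n -> K),
      ideal_set (gamma3 (ker p)) (w - \sum_t c t *: b t)] v.
    case=> c vc; exists c; have [w -> wE] := sum_B c; apply/quot_projP => /=.
    by rewrite -wE in vc.
  have g_sub := ideal_subspace (gamma3 (ker p)).
  have basis t : exists c : 'I_n + ordered_pair n -> K,
      ideal_set (gamma3 (ker p)) (b t - \sum_u c u *: b u).
    exists (fun u => (u == t)%:R); rewrite (bigD1 t) //= eqxx scale1r big1.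
      by rewrite addr0 subrr; case: g_sub.
    by move=> i /negPf ->; rewrite scale0r.
  apply: (lcs3_span F_span p3) v3 => [|j|j k jk|w w3].
  - split=> [|e w w' [c wc] [c' wc']].
      exists (fun=> 0); rewrite big1 ?subr0 => [|t _]; last exact: scale0r.
      by case: g_sub.
    exists (fun t => e * c t + c' t).
    rewrite (eq_bigr (fun t => e *: (c t *: b t) + c' t *: b t)) => [|t _].
      rewrite big_split /= -scaler_sumr opprD addrACA -scalerBr.
      exact: g_sub.2.
    by rewrite scalerDl scalerA.
  - exact: (basis (inl j)).
  - exact: (basis (inr (exist _ (j, k) jk))).
  - exists (fun=> 0); rewrite big1 ?subr0 // => t _; exact: scale0r.
rewrite -card_weights; apply: abelian_isog B_free B_span.
exact: multiplier2_abelian.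
Qed.
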